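(* Let $\mathcal K$ be a relational Fraïssé class which is Ramsey. Then the Ramsey degree for embeddings of $\mathcal K$ is either $\infty$ or equal to $2^m$ for some $m\in\mathbb N$.
   Context: Structures are over a countable relational language $L$ (only relation symbols). For structures $A,B$, $B^A$ denotes the set of embeddings of $A$ into $B$. A class $\mathcal K$ of finite $L$-structures is a Fraïssé class if it is hereditary, has joint embedding, has amalgamation (for $A,B_0,B_1\in\mathcal K$ and $a_i\in B_i^A$ there are $C\in\mathcal K$, $b_i\in C^{B_i}$ with $b_0\circ a_0=b_1\circ a_1$), and contains arbitrarily large finite structures. Write $[k]=\{0,\dots,k-1\}$. For structures $A,B$, $\binom{B}{A}$ denotes the set of substructures of $B$ isomorphic to $A$; $C\to(B)^A_{k,d}$ means: for every $\chi:\binom{C}{A}\to[k]$ there is $B'\in\binom{C}{B}$ with $|\chi(\binom{B'}{A})|\le d$. The Ramsey degree of $A$ in $\mathcal K$ is the least $d$ such that for all $B\in\mathcal K$, $k\ge2$ there is $C\in\mathcal K$ with $C\to(B)^A_{k,d}$ ($\infty$ if none); $\mathcal K$ is Ramsey if every $A\in\mathcal K$ has Ramsey degree $1$. $C\hookrightarrow(B)^A_{k,d}$ means: for every $\chi:C^A\to[k]$ there is $b\in C^B$ with $|\chi(\{b\circ a:a\in B^A\})|\le d$. The Ramsey degree for embeddings of $A$ in $\mathcal K$ is the least $d$ such that for all $B\in\mathcal K$, $k\ge 2$ there is $C\in\mathcal K$ with $C\hookrightarrow(B)^A_{k,d}$ ($\infty$ if none), and that of $\mathcal K$ is the supremum over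 $A\in\mathcal K$. *)

(* Defs.v *)
From mathcomp Require Import all_boot.
Set Implicit Arguments. Unset Strict Implicit. Unset Printing Implicit Defensive.

(* A countable relational language: symbols in a countType I, with arities ar.
   A finite L-structure has carrier 'I_n (n = fsize) and, for each symbol i,
   an interpretation as a boolean predicate on (ar i)-tuples. *)
Record fstruct (I : countType) (ar : I -> nat) := FStruct {
  fsize : nat;
  frel : forall i : I, (ar i).-tuple 'I_fsize -> bool }.

Arguments frel {I ar} f i _.
Arguments fsize {I ar} f.

Section Defs.
Variables (I : countType) (ar : I -> nat).
Local Notation S := (fstruct ar).

Definition is_emb (A B : S) (f : 'I_(fsize A) -> 'I_(fsize B)) : Prop :=
  injective f /\ forall (i : I) (t : (ar i).-tuple 'I_(fsize A)),
    frel B i (map_tuple f t) = frel A i t.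

Definition is_copy (A C : S) (T : {set 'I_(fsize C)}) : Prop :=
  exists f : 'I_(fsize A) -> 'I_(fsize C), is_emb f /\ T = f @: [set: 'I_(fsize A)].

Definition hereditary (K : S -> Prop) : Prop :=
  forall A B : S, K A -> forall f : 'I_(fsize B) -> 'I_(fsize A), is_emb f -> K B.

Definition joint_embedding (K : S -> Prop) : Prop :=
  forall A B : S, K A -> K B -> exists C : S, K C /\
    (exists f : 'I_(fsize A) -> 'I_(fsize C), is_emb f) /\
    (exists g : 'I_(fsize B) -> 'I_(fsize C), is_emb g).

Definition amalgamation (K : S -> Prop) : Prop :=
  forall A B0 B1 : S, K A -> K B0 -> K B1 ->
  forall (a0 : 'I_(fsize A) -> 'I_(fsize B0)) (a1 : 'I_(fsize A) -> 'I_(fsize B1)),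
    is_emb a0 -> is_emb a1 ->
  exists C : S, K C /\
  exists (b0 : 'I_(fsize B0) -> 'I_(fsize C)) (b1 : 'I_(fsize B1) -> 'I_(fsize C)),
    is_emb b0 /\ is_emb b1 /\ forall x, b0 (a0 x) = b1 (a1 x).

Definition arbitrarily_large (K : S -> Prop) : Prop :=
  forall n : nat, exists A : S, K A /\ n <= fsize A.

Definition fraisse_class (K : S -> Prop) : Prop :=
  [/\ hereditary K, joint_embedding K, amalgamation K & arbitrarily_large K].

Definition sub_arrow (A B C : S) (k d : nat) : Prop :=
  forall chi : {set 'I_(fsize C)} -> 'I_k,
  exists B' : {set 'I_(fsize C)}, is_copy B B' /\
  exists cols : {set 'I_k}, #|cols| <= d /\
    forall T : {set 'I_(fsize C)}, is_copy A T -> T \subset B' -> chi T \in cols.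

Definition sub_deg_ok (K : S -> Prop) (A : S) (d : nat) : Prop :=
  forall B : S, K B -> forall k, 2 <= k -> exists C : S, K C /\ sub_arrow A B C k d.

Definition is_ramsey_degree (K : S -> Prop) (A : S) (d : nat) : Prop :=
  sub_deg_ok K A d /\ forall d', sub_deg_ok K A d' -> d <= d'.

Definition ramsey_class (K : S -> Prop) : Prop :=
  forall A : S, K A -> is_ramsey_degree K A 1.

(* C |-> (B)^A_{k,d}; colourings are given on all maps 'I_a -> 'I_c, only their
   values on embeddings C^A matter. *)
Definition emb_arrow (A B C : S) (k d : nat) : Prop :=
  forall chi : {ffun 'I_(fsize A) -> 'I_(fsize C)} -> 'I_k,
  exists b : {ffun 'I_(fsize B) -> 'I_(fsize C)}, is_emb b /\
  exists cols : {set 'I_k}, #|cols| <= d /\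
    forall a : {ffun 'I_(fsize A) -> 'I_(fsize B)}, is_emb a ->
      chi [ffun x => b (a x)] \in cols.

Definition emb_deg_ok (K : S -> Prop) (A : S) (d : nat) : Prop :=
  forall B : S, K B -> forall k, 2 <= k -> exists C : S, K C /\ emb_arrow A B C k d.

Definition is_emb_degree (K : S -> Prop) (A : S) (d : nat) : Prop :=
  emb_deg_ok K A d /\ forall d', emb_deg_ok K A d' -> d <= d'.

(* the Ramsey degree for embeddings of K (sup over A in K) equals D (finite);
   if no such D exists, the degree is infinity *)
Definition bounded_emb_degrees (K : S -> Prop) (D : nat) : Prop :=
  forall A : S, K A -> exists d, is_emb_degree K A d /\ d <= D.

Definition is_class_emb_degree (K : S -> Prop) (D : nat) : Prop :=
  bounded_emb_degrees K D /\ forall D', bounded_emb_degrees K D' -> D <= D'.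

End Defs.

(* Main.v *)
(** Since K is Ramsey for copies, the Ramsey degree for embeddings of A is |Aut A|: the upper
    bound comes from colouring a copy of A by the set of colours of the embeddings onto it, the
    lower bound from colouring an embedding by its order pattern.  It remains to see that if the
    groups Aut B, B in K, have at most D elements, then each Aut A has exponent 2.

    Let g be in Aut A and suppose g^2 a <> a.  Choose B in K with B -> (A)^T for the pair
    T = {a, g^2 a} and 2^D colours.  A first use of Ramsey gives a linear order o on B such that,
    for every embedding x of A into B, the orders pulled back along x \o g and along b \o x
    coincide for some b in Aut B.  Colour a two-element subset of B by the set of those b in Aut B
    that preserve its o-order; there are at most 2^D colours because |Aut B| <= D.  On a
    monochromatic copy of A, whether g preserves the order of {g^j a, g^(j+2) a} does not depend
    on j, so g^2 preserves the order of all these pairs and the g^2-orbit of a is strictly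
    monotone, which is absurd. *)

Require Import Defs.
From mathcomp Require Import all_boot all_fingroup all_solvable.
From mathcomp Require Import boolp.

Set Implicit Arguments.
Unset Strict Implicit.
Unset Printing Implicit Defensive.

Section RamseyAutomorphisms.
Variables (I : countType) (ar : I -> nat).
Implicit Types (A B C T : fstruct ar) (K : fstruct ar -> Prop).

Local Notation dom A := 'I_(fsize A).

(** * Embeddings and automorphism groups *)

Lemma is_emb_comp A B C (f : dom A -> dom B) (g : dom B -> dom C) :
  is_emb f -> is_emb g -> is_emb (g \o f).
Proof.
move=> [injf relf] [injg relg]; split; first exact: inj_comp.
move=> i t; rewrite -relf -relg; apply: congr1.
by apply: val_inj; rewrite /= map_comp.
Qed.

Lemma is_emb_ext A B (f g : dom A -> dom B) : f =1 g -> is_emb f -> is_emb g.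
Proof. by move=> /funext ->. Qed.

Lemma is_emb_id A : is_emb (@id (dom A)).
Proof.
split=> // i t; apply: congr1.
by apply: val_inj; rewrite /= map_id.
Qed.

Lemma is_emb_factor A B C (f : dom A -> dom B) (g : dom B -> dom C) :
  is_emb g -> is_emb (g \o f) -> is_emb f.
Proof.
move=> [injg relg] [injgf relgf]; split; first exact: inj_compr injgf.
move=> i t; rewrite -relgf -relg; apply: congr1.
by apply: val_inj; rewrite /= map_comp.
Qed.

Definition aut A : {set {perm dom A}} := [set s : {perm dom A} | `[< is_emb (A := A) (B := A) s >]].

Lemma autP A (s : {perm dom A}) : reflect (is_emb (A := A) (B := A) s) (s \in aut A).
Proof. by rewrite inE; apply: asboolP. Qed.

Lemma aut_group_set A : group_set (aut A).
Proof.
apply/group_setP; split.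
  by apply/autP; apply: is_emb_ext (is_emb_id A) => x; rewrite perm1.
move=> s t /autP es /autP et; apply/autP.
by apply: is_emb_ext (is_emb_comp es et) => x; rewrite permM.
Qed.

Canonical aut_group A := Group (aut_group_set A).

Lemma emb_same_image A B (f g : dom A -> dom B) :
  is_emb f -> is_emb g -> f @: [set: dom A] = g @: [set: dom A] ->
  exists2 s, s \in aut A & f =1 g \o s.
Proof.
move=> ef eg fg.
have ex x : exists y, g y == f x.
  have: f x \in g @: [set: dom A] by rewrite -fg imset_f.
  by case/imsetP=> y _ ->; exists y.
pose h x := xchoose (ex x).
have gh x : g (h x) = f x by apply/eqP; exact: (xchooseP (ex x)).
have injh : injective h by move=> x y /(congr1 g); rewrite !gh => /(proj1 ef).
exists (perm injh); last by move=> x /=; rewrite permE gh.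
apply/autP; apply: (is_emb_factor eg).
by apply: is_emb_ext ef => x /=; rewrite permE gh.
Qed.

(** * Consequences of the Ramsey property and amalgamation *)

Lemma mono_copies K A B (F : finType) :
  sub_deg_ok K A 1 -> K B ->
  exists2 C, K C & forall c : {set dom C} -> F,
    exists2 b : dom B -> dom C, is_emb b &
    forall e e' : dom A -> dom B, is_emb e -> is_emb e' ->
      c ((b \o e) @: [set: dom A]) = c ((b \o e') @: [set: dom A]).
Proof.
(* Two spare colours secure [2 <= k] whatever the size of [F]. *)
move=> rA KB; have [//|C [KC arr]] := rA B KB (#|F|.+2).
exists C => // c.
have le : #|F| <= #|F|.+2 by rewrite leqW.
have [_ [[b [eb ->]] [cols [cols1 colsP]]]] :=
  arr (fun S => widen_ord le (enum_rank (c S))).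
exists b => // e e' ee ee'.
have in_cols f : is_emb f -> widen_ord le (enum_rank (c ((b \o f) @: [set: dom A]))) \in cols.
  move=> ef; apply: colsP; first by exists (b \o f); split=> //; exact: is_emb_comp.
  by apply/subsetP=> _ /imsetP[x _ ->]; apply: imset_f.
have /(_ _ _ (in_cols e ee) (in_cols e' ee')) := card_le1_eqP cols1.
by move=> /(congr1 val) /= /val_inj /enum_rank_inj.
Qed.

(** The pairs are treated one by one: a fresh copy of [B] is amalgamated with the structure built so
    far, and the embeddings already found survive by composition. *)
Lemma simultaneous_amalgam K A B (s : seq ({ffun dom A -> dom B} * {ffun dom A -> dom B})) :
  amalgamation K -> K A -> K B ->
  (forall p, p \in s -> is_emb p.1 /\ is_emb p.2) ->
  exists2 C, K C & exists2 z0 : dom B -> dom C, is_emb z0 &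
    forall p, p \in s -> exists2 z : dom B -> dom C, is_emb z & z \o p.1 =1 z0 \o p.2.
Proof.
move=> am KA KB; elim: s => [|p s IHs] embs.
  by exists B => //; exists id => //; exact: is_emb_id.
have [|C KC [z0 ez0 zP]] := IHs; first by move=> q qs; apply: embs; rewrite inE qs orbT.
have [ep1 ep2] := embs p (mem_head _ _).
have [E [KE [b0 [b1 [eb0 [eb1 bE]]]]]] := am A B C KA KB KC _ _ ep1 (is_emb_comp ep2 ez0).
exists E => //; exists (b1 \o z0); first exact: is_emb_comp.
move=> q; rewrite inE => /orP[/eqP->|qs].
  by exists b0 => // x; apply: bE.
have [z ez zq] := zP q qs; exists (b1 \o z); first exact: is_emb_comp.
by move=> x /=; congr b1; apply: zq.
Qed.

(* The order on B is induced by the numbering of a large C in which all copies of B carry the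
   same set of orders: the order that a copy z induces, where z \o x = z0 \o x \o g, is then
   carried to the one induced by z0 by an automorphism of B. *)
Lemma order_absorbs_aut K A B (g : {perm dom A}) :
  fraisse_class K -> ramsey_class K -> K A -> K B -> g \in aut A ->
  exists2 o : dom B -> nat, injective o &
    forall x : dom A -> dom B, is_emb x -> exists2 b, b \in aut B &
      forall u v, (o (b (x u)) < o (b (x v))) = (o (x (g u)) < o (x (g v))).
Proof.
move=> [_ _ am _] ram KA KB /autP eg.
pose s := [seq (x, [ffun u => x (g u)]) | x : {ffun dom A -> dom B} in
  [pred x : {ffun dom A -> dom B} | `[< is_emb x >]]].
have [|E KE [z0 ez0 zP]] := @simultaneous_amalgam K A B s am KA KB.
  move=> p /imageP[x /asboolP ex ->]; split=> //=.
  by apply: is_emb_ext (is_emb_comp eg ex) => u; rewrite ffunE.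
pose F := {ffun dom B * dom B -> bool}.
have [C KC mono] := mono_copies {set F} (proj1 (ram B KB)) KE.
pose pat (e : dom B -> dom C) : F := [ffun p => e p.1 < e p.2].
pose col (S : {set dom C}) : {set F} := [set q | `[< exists2 e : dom B -> dom C,
  is_emb e & e @: [set: dom B] = S /\ q = pat e >]].
have [d ed dP] := mono col.
exists (fun u => d (z0 u)) => [u v /val_inj /(proj1 ed) /(proj1 ez0) //|x ex].
have exf : is_emb [ffun u => x u] by apply: is_emb_ext ex => u; rewrite ffunE.
have [|z ez zx] := zP ([ffun u => x u], [ffun u => [ffun u => x u] (g u)]).
  by apply/imageP; exists [ffun u => x u] => //; apply/asboolP.
(* Equal colours make the order induced by [d \o z] occur on the copy given by [d \o z0], through
   some embedding [w]; having the same image, [w] and [d \o z0] differ by an automorphism. *)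
have : pat (d \o z) \in col ((d \o z0) @: [set: dom B]).
  rewrite (dP _ z) // inE; apply/asboolP; exists (d \o z) => //.
  exact: is_emb_comp.
rewrite inE => /asboolP[w ew [wim wpat]].
have [b bB wb] := emb_same_image ew (is_emb_comp ez0 ed) wim.
exists b => // u v.
have zxE t : z (x t) = z0 (x (g t)) by have := zx t; rewrite /= !ffunE.
move/ffunP: wpat => /(_ (x u, x v)); rewrite !ffunE /= !zxE !wb /= => ->.
by [].
Qed.

(** * Automorphism groups of exponent 2 *)

Definition substruct A n (j : 'I_n -> dom A) : fstruct ar :=
  @FStruct I ar n (fun i t => Defs.frel A i (map_tuple j t)).

Lemma substruct_emb A n (j : 'I_n -> dom A) :
  injective j -> is_emb (A := substruct j) (B := A) j.
Proof. by []. Qed.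

(** Depends on an unordered set only, so that it can colour copies. *)
Definition agree (X : finType) (o o' : X -> nat) (S : {set X}) : bool :=
  [forall u in S, forall v in S, (o u < o v) == (o' u < o' v)].

Lemma agree2 (X : finType) (o o' : X -> nat) x y :
  injective o -> injective o' -> x != y ->
  agree o o' [set x; y] = ((o x < o y) == (o' x < o' y)).
Proof.
move=> injo injo' xy; apply/idP/idP.
  by move=> /forall_inP/(_ x (set21 _ _))/forall_inP/(_ y (set22 _ _)).
have flip (f : X -> nat) : injective f -> (f y < f x) = ~~ (f x < f y).
  by move=> injf; rewrite -leqNgt ltn_neqAle (inj_eq injf) eq_sym xy.
move=> /eqP oo'; apply/forall_inP=> u; rewrite !inE => /orP[] /eqP->;
  apply/forall_inP=> v; rewrite !inE => /orP[] /eqP->;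
  by rewrite ?ltnn ?flip // oo'.
Qed.

Lemma aut_involutive K A (D : nat) (g : {perm dom A}) :
  fraisse_class K -> ramsey_class K -> K A ->
  (forall B, K B -> #|aut B| <= D) -> g \in aut A -> forall a, g (g a) = a.
Proof.
move=> fr ram KA bD gA a; apply/eqP/negPn/negP => ne.
have [her _ _ _] := fr.
pose j (i : 'I_2) := if i == ord0 then a else g (g a).
have injj : injective j.
  move=> [[|[|//]] p] [[|[|//]] q]; rewrite /j /= => h; apply/val_inj => //=.
    by rewrite -h eqxx in ne.
  by rewrite h eqxx in ne.
pose T := substruct j.
have ej : is_emb (A := T) (B := A) j := substruct_emb injj.
have KT : K T := her A T KA j ej.
(* The colours must be fixed before [B] is known, so the bits are indexed by ['I_D] and later read
   through the enumeration of [aut B]; indices past its end stand for the identity. *)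
have [B KB mono] := mono_copies {ffun 'I_D -> bool} (proj1 (ram T KT)) KA.
have [o injo oP] := order_absorbs_aut fr ram KA KB gA.
pose bt (d : nat) := nth 1%g (enum (aut B)) d.
have [x ex xP] := mono (fun S => [ffun d : 'I_D => agree o (o \o bt d) S]).
have [b bB bP] := oP x ex.
pose y n := x (iter n g a).
have yne n : y n != y n.+2.
  rewrite /y (inj_eq (proj1 ex)); elim: n => [|n IHn]; first by rewrite eq_sym.
  by rewrite [iter n.+1 g a]iterS [iter n.+3 g a]iterS (inj_eq perm_inj).
have ltD : index b (enum (aut B)) < D.
  by apply: leq_trans (bD B KB); rewrite cardE index_mem mem_enum.
have btE : bt (Ordinal ltD) = b by rewrite /bt nth_index // mem_enum.
have iterE n : is_emb (A := A) (B := A) (iter n g).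
  elim: n => [|n IHn]; first exact: is_emb_id.
  by apply: is_emb_comp IHn _; apply/autP.
have imE n : (x \o (iter n g \o j)) @: [set: dom T] = [set y n; y n.+2].
  apply/setP=> u; rewrite !inE; apply/imsetP/orP.
    move=> [[[|[|//]] p] _ ->]; rewrite /= /j /=; [left|right] => //.
    by rewrite /y -iterSr -iterSr.
  case=> /eqP->; first by exists ord0.
  by exists ord_max => //; rewrite /y /= /j /= -!iterSr.
pose P n := o (y n) < o (y n.+2).
have PP n : (P n == P n.+1) = (P 0 == P 1).
  (* By [bP], [b] carries the pair at step [m] to one ordered like the pair at step [m.+1]. *)
  have ag m : agree o (o \o b) [set y m; y m.+2] = (P m == P m.+1).
    rewrite agree2 //; first by rewrite /= bP.
    by apply: inj_comp injo _; apply: perm_inj.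
  rewrite -!ag -!imE.
  have := xP _ _ (is_emb_comp ej (iterE n)) (is_emb_comp ej (iterE 0)).
  by move=> /ffunP/(_ (Ordinal ltD)); rewrite !ffunE btE.
(* [P] is either constant or alternating, hence has period 2 in both cases. *)
have P2 n : P n.*2 = P 0.
  elim: n => [//|n IHn]; rewrite doubleS -IHn.
  have := PP n.*2; have := PP n.*2.+1; case: (P 0 == P 1);
  by case: (P n.*2); case: (P n.*2.+1); case: (P n.*2.+2).
have per : y (#[g]%g.*2) = y 0.
  by rewrite /y -permX -addnn expgD expg_order mul1g perm1.
have og := order_gt0 g.
case P0: (P 0).
  have lt n : o (y 0) < o (y n.+1.*2).
    elim: n => [|n IHn]; first exact: P0.
    by apply: ltn_trans IHn _; have := P2 n.+1; rewrite P0.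
  by have := lt #[g]%g.-1; rewrite prednK // per ltnn.
have gt n : o (y n.*2.+2) < o (y n.*2).
  by rewrite ltnNge leq_eqVlt (inj_eq injo) (negPf (yne _)) -/(P n.*2) P2 P0.
have lt n : o (y n.+1.*2) < o (y 0).
  elim: n => [|n IHn]; first exact: (gt 0).
  by apply: ltn_trans IHn; apply: gt.
by have := lt #[g]%g.-1; rewrite prednK // per ltnn.
Qed.

(** By Cauchy, each prime divisor of the order is the order of an element whose square is 1. *)
Lemma card_aut_pow2 K A (D : nat) :
  fraisse_class K -> ramsey_class K -> K A ->
  (forall B, K B -> #|aut B| <= D) -> exists m, #|aut A| = 2 ^ m.
Proof.
move=> fr ram KA bD.
suff: (2.-group (aut A))%g by move=> /card_pgroup h; eexists; exact: h.
apply/pgroupP=> p pr /(Cauchy pr)[g gA og].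
have g2 : (g ^+ 2 = 1)%g.
  by apply/permP=> a; rewrite perm1 permX; apply: (aut_involutive fr ram KA bD gA).
by have /eqP := g2; rewrite -order_dvdn og dvdn_prime2.
Qed.

(** * Embedding degrees as orders of automorphism groups *)

Lemma emb_deg_ok_aut K A : sub_deg_ok K A 1 -> emb_deg_ok K A #|aut A|.
Proof.
move=> rA B KB k _.
have [C KC mono] := mono_copies {set 'I_k} rA KB; exists C; split=> // chi.
pose col (S : {set dom C}) := [set q | `[< exists2 e : {ffun dom A -> dom C},
  is_emb e & e @: [set: dom A] = S /\ q = chi e >]].
have [b eb bP] := mono col.
exists (finfun b); split; first by apply: is_emb_ext eb => u; rewrite ffunE.
have bin (a : {ffun dom A -> dom B}) : is_emb a ->
    chi [ffun u => finfun b (a u)] \in col ((b \o a) @: [set: dom A]).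
  move=> ea; rewrite inE; apply/asboolP; exists [ffun u => finfun b (a u)].
    by apply: is_emb_ext (is_emb_comp ea eb) => u; rewrite !ffunE.
  by split=> //; apply: eq_imset => u; rewrite !ffunE.
have [[a0 ea0]|no] := pselect (exists a : {ffun dom A -> dom B}, is_emb a); last first.
  by exists set0; rewrite cards0; split=> // a ea; case: no; exists a.
exists (col ((b \o a0) @: [set: dom A])); split; last first.
  by move=> a ea; rewrite (bP a0 a) //; apply: bin.
(* Every embedding onto this copy is [b \o a0 \o s] with [s] in [aut A]. *)
apply: leq_trans (leq_imset_card (fun s : {perm dom A} => chi [ffun u => b (a0 (s u))]) _).
apply/subset_leq_card/subsetP=> q; rewrite inE => /asboolP[e ee [eim ->]].
have [s sA es] := emb_same_image ee (is_emb_comp ea0 eb) eim.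
by apply/imsetP; exists s => //; congr chi; apply/ffunP=> u; rewrite ffunE es.
Qed.

(* Colouring an embedding by the permutation that sorts it separates e \o s for distinct
   automorphisms s, as these all have the same image. *)
Lemma emb_deg_ge_aut K A d : K A -> emb_deg_ok K A d -> #|aut A| <= d.
Proof.
move=> KA /(_ A KA).
(* The successor lets [inord] be used even if [A] is empty. *)
pose F : finType := {ffun dom A -> 'I_(fsize A).+1}.
move=> /(_ #|F|.+2 isT) [C [_ arr]].
have le : #|F| <= #|F|.+2 by rewrite leqW.
pose rk (e : {ffun dom A -> dom C}) : F :=
  [ffun u => inord (index (e u) (enum (e @: [set: dom A])))].
have [b [eb [cols [cols_d colsP]]]] := arr (fun e => widen_ord le (enum_rank (rk e))).
apply: leq_trans cols_d.
pose bs (s : {perm dom A}) := [ffun u => b ([ffun v => s v] u)].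
have bsim s : bs s @: [set: dom A] = b @: [set: dom A].
  apply/setP=> v; apply/imsetP/imsetP=> -[u _ ->].
    by exists (s u); rewrite ?inE // !ffunE.
  by exists ((s^-1)%g u); rewrite ?inE // !ffunE permKV.
have inj : injective (fun s => widen_ord le (enum_rank (rk (bs s)))).
  move=> s t /(congr1 val) /= /val_inj /enum_rank_inj /ffunP h.
  apply/permP=> u; have := h u; rewrite !ffunE !bsim => /(congr1 val) /=.
  have mem w : b w \in enum (b @: [set: dom A]) by rewrite mem_enum imset_f.
  have idx w : index (b w) (enum (b @: [set: dom A])) < (fsize A).+1.
    rewrite ltnS -[X in _ <= X]card_ord -cardsT; apply: leq_trans (leq_imset_card b _).
    by rewrite cardE index_size.
  rewrite !inordK // => /(congr1 (nth (b u) (enum (b @: [set: dom A])))).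
  by rewrite !nth_index //; apply: (proj1 eb).
rewrite -(card_imset _ inj); apply/subset_leq_card/subsetP=> _ /imsetP[s /autP es ->].
by apply: colsP; apply: is_emb_ext es => u; rewrite ffunE.
Qed.

Lemma emb_degreeE K A d : ramsey_class K -> K A -> is_emb_degree K A d <-> d = #|aut A|.
Proof.
move=> ram KA; have ok := emb_deg_ok_aut (proj1 (ram A KA)); split=> [[okd mind]|->].
  by apply/eqP; rewrite eqn_leq mind // (emb_deg_ge_aut KA).
by split=> // d'; apply: emb_deg_ge_aut.
Qed.

Lemma bounded_emb_degreesE K D :
  ramsey_class K -> bounded_emb_degrees K D <-> forall A, K A -> #|aut A| <= D.
Proof.
move=> ram; split=> bD A KA; last by exists #|aut A|; split; [apply/emb_degreeE|apply: bD].
by have [d [/emb_degreeE-> //]] := bD A KA.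
Qed.

End RamseyAutomorphisms.

Theorem mainTheorem2 (I : countType) (ar : I -> nat) (K : fstruct ar -> Prop) :
  fraisse_class K -> ramsey_class K ->
  (forall D : nat, ~ is_class_emb_degree K D) \/
  (exists m : nat, is_class_emb_degree K (2 ^ m)).
Proof.
move=> fr ram; have [[D dD]|no] := pselect (exists D, is_class_emb_degree K D); last first.
  by left=> D dD; apply: no; exists D.
right; have [/bounded_emb_degreesE-/(_ ram) bD minD] := dD.
have [_ _ _ /(_ 0)[A0 [KA0 _]]] := fr.
(* The largest exponent that occurs gives a bound on all the groups, attained by one of them, so it
   yields [D]. *)
pose Q m := `[< exists2 A, K A & #|aut A| = 2 ^ m >].
have exQ : exists m, Q m.
  by have [m Am] := card_aut_pow2 fr ram KA0 bD; exists m; apply/asboolP; exists A0.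
have Qle m : Q m -> m <= D.
  move=> /asboolP[A KA Am]; apply: leq_trans (bD A KA).
  by rewrite Am ltnW // ltn_expl.
case: (ex_maxnP exQ Qle) => m /asboolP[A KA Am] maxm.
exists m; suff -> : 2 ^ m = D by [].
apply/eqP; rewrite eqn_leq -{1}Am bD //=; apply: minD.
apply/bounded_emb_degreesE => // B KB.
have [n Bn] := card_aut_pow2 fr ram KB bD.
by rewrite Bn leq_exp2l // maxm //; apply/asboolP; exists B.
Qed.
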